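(* Consider the planted submatrix problem with $\rho\le1/2$. Let $k\ge0$ be an integer, $D=2k+1$, and $f(Y)=\tau_k\big(\frac{1}{\lambda\rho n}\sum_{i=1}^nY_{1i}\big)$. For any $0<r<1$, if \[ \lambda\ge\frac{24}{r\rho\sqrt n}\sqrt{\log8+2D\log(9/\rho)} \quad\text{and}\quad \rho\ge\frac{324}{r^2n}\big[\log8+2D\log(9/\rho)\big], \] then $\mathbb{E}(f(Y)-x)^2\le D^2r^{D-1}$.
   Context: Planted submatrix problem: observe $Y=\lambda vv^\top+W$ ($n\times n$), where $v\in\{0,1\}^n$ has i.i.d. $\mathrm{Bernoulli}(\rho)$ entries, $W$ is symmetric with $W_{ij}=W_{ji}\sim\mathcal{N}(0,1)$ for $i<j$, $W_{ii}\sim\mathcal{N}(0,2)$, the $\{W_{ij}:i\le j\}$ independent and independent of $v$; $\lambda>0$, $\rho\in(0,1)$; target $x=v_1$. $\tau_k(y)=(2k+1)\binom{2k}{k}\int_0^yt^k(1-t)^k\,dt$, a polynomial of degree $2k+1$. Logarithms are natural. *)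

(* Defs.v *)
From mathcomp Require Import all_boot all_order all_algebra.
From mathcomp Require Import all_classical all_reals all_analysis.
Import Order.TTheory GRing.Theory Num.Theory.
Import numFieldNormedType.Exports.
Local Open Scope classical_set_scope.
Local Open Scope ring_scope.

Set Implicit Arguments.
Unset Strict Implicit.
Unset Printing Implicit Defensive.

Definition oriented_integral0 {R : realType} (g : R -> R) (y : R) : R :=
  if 0 <= y then Rintegral lebesgue_measure `[0, y] g
  else - Rintegral lebesgue_measure `[y, 0] g.

Definition tau {R : realType} (k : nat) (y : R) : R :=
  (k.*2.+1)%:R * ('C(k.*2, k))%:R *
  oriented_integral0 (fun t => t ^+ k * (1 - t) ^+ k) y.

Definition mutually_independent {d : measure_display} {T : measurableType d}
  {R : realType} (P : probability T R) (I : finType) (X : I -> T -> R) : Prop :=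
  forall B : I -> set R, (forall i, measurable (B i)) ->
    fine (P (\bigcap_(i in [set: I]) (X i @^-1` B i))) =
    \prod_(i : I) fine (P (X i @^-1` B i)).

(* index set of the independent entries: v_i (inl i) and W_ij, i <= j (inr) *)
Definition upper_index (n : nat) : finType :=
  {p : 'I_n * 'I_n | (p.1 <= p.2)%N}.

(* Main.v *)
Require Import Defs.
From mathcomp Require Import all_boot all_order all_algebra.
From mathcomp Require Import all_classical all_reals all_analysis measurable_realfun.
From mathcomp Require Import ring lra.
Import Order.TTheory GRing.Theory Num.Theory.
Import numFieldNormedType.Exports.
Local Open Scope classical_set_scope.
Local Open Scope ring_scope.

(** The error [e = z - v_1] of the rescaled row sum [z] splits as
    [v_1 (S - 1) + N] with [S = (sum_i v_i) / (rho n)] and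
    [N = (sum_j W_1j) / (lambda rho n)].  The derivative of [tau_k] is
    [D binom(2k,k) t^k (1-t)^k], which vanishes to order [k] at the fixed points
    [0] and [1] of [tau_k]; hence
    [|tau_k(z) - v_1| <= D |e| (4 |e| (1 + |e|))^k].  Instead of truncating on a
    good event, this power is dominated by [exp (4 D |e| / r)] times a small
    constant, so that everything reduces to the moment generating function of
    [e] at [+- 8 D / r].  It is bounded by independence, from the explicit
    Gaussian and Bernoulli moment generating functions; the logarithmic
    factor [L] is only used through [L >= 2 D]. *)

(** * Polynomial calculus: antiderivatives, oriented integrals, mean value bounds *)

Lemma poly_antiderivative (R : numFieldType) (q : {poly R}) :
  exists p : {poly R}, p^`() = q /\ p.[0] = 0.
Proof.
exists (\sum_(i < size q) (q`_i / i.+1%:R) *: 'X^(i.+1)); split.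
  rewrite raddf_sum -[RHS]coefK poly_def /=; apply: eq_bigr => i _.
  by rewrite derivZ derivXn -scalerMnr scalerMnl -mulr_natr divfK// pnatr_eq0.
rewrite horner_sum big1// => i _.
by rewrite hornerZ hornerXn expr0n mulr0.
Qed.

Lemma oriented_integral0_poly (R : realType) (p : {poly R}) (y : R) :
  oriented_integral0 (horner p^`()) y = p.[y] - p.[0].
Proof.
have FTC (a b : R) : a <= b ->
    Rintegral lebesgue_measure `[a, b] (horner p^`()) = p.[b] - p.[a].
  rewrite le_eqVlt => /predU1P[->|ab].
    by rewrite set_itv1 Rintegral_set1 subrr.
  rewrite /Rintegral (@continuous_FTC2 _ _ (horner p)) //.
  - by apply: continuous_subspaceT => x; exact: continuous_horner.
  - split => [x _||]; first exact: derivable_horner.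
    + by apply: cvg_at_right_filter; exact: continuous_horner.
    + by apply: cvg_at_left_filter; exact: continuous_horner.
  - by move=> x _; rewrite derivE.
rewrite /oriented_integral0; case: ifPn => [y0|]; first exact: FTC.
by rewrite -ltNge => /ltW y0; rewrite FTC// opprB.
Qed.

(** Mean value theorem. The derivative is bounded on the symmetric ball around [a], so [b] may lie
    on either side. *)
Lemma horner_dist_le (R : realType) (p : {poly R}) (a b M : R) :
  (forall t, `|t - a| <= `|b - a| -> `|(p^`()).[t]| <= M) ->
  `|p.[b] - p.[a]| <= M * `|b - a|.
Proof.
move=> HM.
have step (u v : R) : u <= v ->
    (forall t, u <= t <= v -> `|(p^`()).[t]| <= M) ->
    `|p.[v] - p.[u]| <= M * `|v - u|.
  move=> uv HMuv.
  have dp x : x \in `]u, v[%R -> is_derive x 1 (horner p) (p^`()).[x].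
    by move=> _; exact: is_derive_poly.
  have cp : {within `[u, v], continuous (horner p)}.
    by apply: continuous_subspaceT => x; exact: continuous_horner.
  have [t] := MVT_segment uv dp cp.
  rewrite in_itv/= => tuv ->; rewrite normrM ler_wpM2r//; exact: HMuv.
have [ab|/ltW ba] := leP a b.
  apply: step => // t /andP[ta tb]; apply: HM.
  by rewrite !ger0_norm ?subr_ge0// lerB.
rewrite distrC [X in _ * X]distrC; apply: step => // t /andP[ta tb]; apply: HM.
by rewrite distrC [X in _ <= X]distrC !ger0_norm ?subr_ge0// lerB.
Qed.

(** The central coefficient is one term of the binomial expansion of [(1 + 1) ^ 2k]. *)
Lemma central_bin_le (k : nat) : ('C(k.*2, k) <= 4 ^ k)%N.
Proof.
rewrite -[4%N]/(2 ^ 2)%N -expnM mul2n -[X in (_ <= X ^ _)%N]/(1 + 1)%N expnDn.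
have kk : (k < k.*2.+1)%N by rewrite ltnS -addnn leq_addr.
by rewrite (bigD1 (Ordinal kk)) //= !exp1n !muln1 leq_addr.
Qed.

(** * The polynomial [tau k] near its fixed points 0 and 1 *)

Section tau_bounds.
Variables (R : realType) (k : nat).

Let c : R := (k.*2.+1)%:R * ('C(k.*2, k))%:R.
Let q : {poly R} := 'X^k * (1 - 'X) ^+ k.

Lemma tau_poly : exists p : {poly R},
  (tau k = horner p) /\ p^`() = c *: q.
Proof.
have [p [pq p0]] := poly_antiderivative _ q; exists (c *: p).
split; last by rewrite derivZ pq.
apply/funext => y; rewrite /tau hornerZ; congr *%R.
have := oriented_integral0_poly _ p y; rewrite p0 subr0 => <-.
congr oriented_integral0; apply/funext => t.
by rewrite pq /q !hornerE.
Qed.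

Lemma tau0 : @tau R k 0 = 0.
Proof.
by rewrite /tau /oriented_integral0 lexx set_itv1 Rintegral_set1 mulr0.
Qed.

Lemma tau1 : @tau R k 1 = 1.
Proof.
rewrite /tau /oriented_integral0 ler01.
(* The integral is the beta value [k! k! / (2k+1)!], exactly the inverse of the normalising constant
   of [tau]. *)
have := @beta_fun_fact R k k; rewrite /beta_fun -Rintegral_mkcond /= /XMonemX => ->.
have := @bin_fact k.*2 k; rewrite -addnn leq_addr addnK => /(_ isT) kk.
rewrite factS -[in RHS](divff (x := ((k + k).+1 * (k + k)`!)%:R : R)).
  by rewrite -kk !natrM; ring.
by rewrite pnatr_eq0 muln_eq0 negb_or /= -lt0n fact_gt0.
Qed.

Lemma measurable_tau : measurable_fun setT (@tau R k).
Proof. by have [p [-> _]] := tau_poly; exact: measurable_poly. Qed.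

(** For [t] within [|e|] of [x], one of [|t|], [|1 - t|] is at most [|e|] and the other at most
    [1 + |e|]. This bounds the derivative on the ball; the 4 comes from the central binomial
    coefficient. *)
Lemma tau_dist_le (x e : R) : x = 0 \/ x = 1 ->
  `|tau k (x + e) - x| <= (k.*2.+1)%:R * `|e| * (4 * `|e| * (1 + `|e|)) ^+ k.
Proof.
move=> x01.
have [p [tp p'q]] := tau_poly.
have -> : tau k (x + e) - x = p.[x + e] - p.[x].
  by rewrite -tp; case: x01 => ->; rewrite ?tau0 ?tau1.
have H : `|p.[x + e] - p.[x]| <= c * (`|e| * (1 + `|e|)) ^+ k * `|x + e - x|.
  apply: horner_dist_le => t; rewrite addrAC subrr add0r => te.
  rewrite p'q hornerZ normrM ger0_norm ?mulr_ge0//.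
  rewrite ler_wpM2l ?mulr_ge0// /q !hornerE -exprMn normrX.
  rewrite lerXn2r ?nnegrE ?mulr_ge0 ?addr_ge0//.
  rewrite normrM.
  have {x01} : `|t| <= `|e| /\ `|1 - t| <= 1 + `|e| \/
      `|t| <= 1 + `|e| /\ `|1 - t| <= `|e|.
    case: x01 te => ->; rewrite ?subr0.
    - by left; split=> //; rewrite (le_trans (ler_normB _ _))// normr1 lerD2l.
    - right; split; last by rewrite distrC.
      by rewrite -[t](subrK 1) (le_trans (ler_normD _ _))// normr1 addrC lerD2l.
  case=> -[h1 h2]; first by rewrite ler_pM.
  by rewrite mulrC ler_pM.
apply: (le_trans H); rewrite addrAC subrr add0r.
rewrite [leRHS]mulrAC -mulrA [X in _ <= X * _](_ : _ =
  (k.*2.+1)%:R * (4 ^+ k * (`|e| * (1 + `|e|)) ^+ k)); last first.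
  by rewrite -!exprMn mulrA.
rewrite /c -!mulrA ler_wpM2l// !mulrA ler_wpM2r// ler_wpM2r ?exprn_ge0 ?mulr_ge0 ?addr_ge0//.
by rewrite -natrX ler_nat central_bin_le.
Qed.

End tau_bounds.

(** * Extending an integral identity from indicators to nonnegative functions *)

Section transfer.
Context d1 d2 d3 (T1 : measurableType d1) (T2 : measurableType d2)
  (U : measurableType d3) (R : realType).
Variables (mu : {measure set T1 -> \bar R}) (nu : {measure set T2 -> \bar R}).
Variables (X : T1 -> U) (Y : T2 -> U) (H : T1 -> R) (c : R).
Hypothesis mX : measurable_fun setT X.
Hypothesis mY : measurable_fun setT Y.
Hypothesis mH : measurable_fun setT H.
Hypothesis H0 : forall t, 0 <= H t.
Hypothesis HXY : forall B, measurable B ->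
  (\int[mu]_t (H t * \1_B (X t))%:E = c%:E * nu (Y @^-1` B))%E.

Import HBNNSimple.

(** A simple function is the finite sum of its values times the indicators of its level sets, and
    [HXY] applies to each level set. *)
Lemma integral_transfer_nnsfun (g : {nnsfun U >-> R}) :
  (\int[mu]_t (H t * g (X t))%:E = c%:E * \int[nu]_t (g (Y t))%:E)%E.
Proof.
have mpre B : measurable B -> measurable (X @^-1` B).
  by move=> mB; rewrite -[X in measurable X]setTI; exact: mX.
have mpreY B : measurable B -> measurable (Y @^-1` B).
  by move=> mB; rewrite -[X in measurable X]setTI; exact: mY.
have mgy y : measurable (g @^-1` [set y]).
  by rewrite -[X in measurable X]setTI; exact: measurable_funP.
transitivity (\int[mu]_t (\sum_(y \in range g)
    (y * (H t * \1_(g @^-1` [set y]) (X t)))%:E))%E.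
  apply: eq_integral => t _; rewrite fsumEFin//; congr EFin.
  rewrite [X in _ * X]fimfunE mulr_fsumr//.
  by apply: eq_fsbigr => y _; rewrite mulrCA.
have pos y u : 0 <= y * \1_(g @^-1` [set y]) u.
  by have := nnfun_muleindic_ge0 g y u; rewrite -EFinM lee_fin.
have mind (T : measurableType _) (Z : T -> U) y : measurable_fun setT Z ->
    measurable_fun setT (fun t => (\1_(g @^-1` [set y]) (Z t) : R)).
  by move=> mZ; apply: measurableT_comp.
rewrite ge0_integral_fsum//; last 2 first.
- move=> y; apply/measurable_EFinP; apply: measurable_funM => //.
  by apply: measurable_funM => //; exact: mind.
- by move=> y t _; rewrite lee_fin mulrCA mulr_ge0.
transitivity (c%:E * \int[nu]_t (\sum_(y \in range g)
    (y * \1_(g @^-1` [set y]) (Y t))%:E))%E; last first.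
  congr (_ * _)%E; apply: eq_integral => t _; rewrite fsumEFin//.
  by rewrite -fimfunE.
rewrite ge0_integral_fsum//; last 2 first.
- move=> y; apply/measurable_EFinP; apply: measurable_funM => //; exact: mind.
- by move=> y t _; rewrite lee_fin.
rewrite ge0_mule_fsumr; last by move=> y; apply: integral_ge0 => t _; rewrite lee_fin.
apply: eq_fsbigr => y /set_mem[u _ <-{y}].
have gu0 : 0 <= g u by [].
under eq_integral do rewrite EFinM.
rewrite ge0_integralZl_EFin//; last 2 first.
- by move=> t _; rewrite lee_fin mulr_ge0.
- by apply/measurable_EFinP; apply: measurable_funM => //; exact: mind.
under [in RHS]eq_integral do rewrite EFinM.
rewrite ge0_integralZl_EFin//; last first.
  by apply/measurable_EFinP; exact: mind.
rewrite HXY// muleCA; congr (_ * (_ * _))%E.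
by have := integral_indic nu measurableT (mpreY _ (mgy (g u))); rewrite setIT => <-.
Qed.

(** Monotone convergence along simple approximations. The weight [H] and factor [c] allow two uses:
    [H] a density with [c = 1], and [H] a product of independent factors with [c] its mean. *)
Lemma integral_transfer (g : U -> R) :
  measurable_fun setT g -> (forall u, 0 <= g u) ->
  (\int[mu]_t (H t * g (X t))%:E = c%:E * \int[nu]_t (g (Y t))%:E)%E.
Proof.
move=> mg g0.
have mg' : measurable_fun setT (fun u => (g u)%:E) by exact/measurable_EFinP.
pose h := nnsfun_approx measurableT mg'.
have hg u : (h n u)%:E @[n --> \oo] --> (g u)%:E.
  by apply: (cvg_nnsfun_approx measurableT mg') => // v _; rewrite lee_fin.
have ndh u : {homo (fun n => h n u) : m n / (m <= n)%N >-> m <= n}.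
  by move=> m n mn; have /lefP := nd_nnsfun_approx measurableT mg' mn; exact.
have mhX n : measurable_fun setT (fun t => H t * h n (X t)).
  apply: measurable_funM => //; apply: measurableT_comp => //.
have L : (\int[mu]_t (H t * h n (X t))%:E @[n --> \oo] -->
    \int[mu]_t (H t * g (X t))%:E)%E.
  rewrite (_ : (fun t => (H t * g (X t))%:E) =
    (fun t => limn (fun n => (H t * h n (X t))%:E))); last first.
    apply/funext => t; apply/esym/cvg_lim => //.
    apply/cvg_EFin; first by exact: nearW.
    by apply: cvgMr; have /fine_cvg := hg (X t).
  apply: cvg_monotone_convergence => //.
  - by move=> n; exact/measurable_EFinP.
  - by move=> n t _; rewrite lee_fin mulr_ge0.
  - by move=> t _ m n mn; rewrite lee_fin ler_wpM2l// ndh.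
have L' : (c%:E * \int[nu]_t (h n (Y t))%:E @[n --> \oo] -->
    c%:E * \int[nu]_t (g (Y t))%:E)%E.
  apply: cvgeZl => //.
  rewrite (_ : (fun t => (g (Y t))%:E) =
    (fun t => limn (fun n => (h n (Y t))%:E))); last first.
    by apply/funext => t; apply/esym/cvg_lim.
  apply: cvg_monotone_convergence => //.
  - by move=> n; apply/measurable_EFinP; apply: measurableT_comp.
  - by move=> n t _; rewrite lee_fin.
  - by move=> t _ m n mn; rewrite lee_fin ndh.
have E : (fun n => \int[mu]_t (H t * h n (X t))%:E)%E =
    (fun n => c%:E * \int[nu]_t (h n (Y t))%:E)%E.
  by apply/funext => n; exact: integral_transfer_nnsfun.
rewrite E in L; exact: (cvg_unique _ L L').
Qed.

End transfer.

(** * Expectation of a product of functions of independent variables *)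

Section independence.
Context d (T : measurableType d) (R : realType) (P : probability T R).
Variables (I : finType) (X : I -> T -> R) (g : I -> R -> R) (m : I -> R).
Hypothesis mX : forall i, measurable_fun setT (X i).
Hypothesis mg : forall i, measurable_fun setT (g i).
Hypothesis g0 : forall i x, 0 <= g i x.
Hypothesis gm : forall i, (\int[P]_t (g i (X i t))%:E = (m i)%:E)%E.

(** Hybrid family: [g i] on the coordinates already treated, indicators of arbitrary sets on the
    others. [M] collects the corresponding means. Leaving the sets free is what makes the induction
    go through. *)
Let F (s : seq I) (B : I -> set R) i : R -> R :=
  if i \in s then g i else \1_(B i).
Let M (s : seq I) (B : I -> set R) i : R :=
  if i \in s then m i else fine (P (X i @^-1` B i)).

Let mF s B i : measurable (B i) -> measurable_fun setT (F s B i).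
Proof. by move=> mB; rewrite /F; case: ifP. Qed.

Let F0 s B i x : 0 <= F s B i x.
Proof. by rewrite /F; case: ifP. Qed.

Let mpre i B : measurable B -> measurable (X i @^-1` B).
Proof. by move=> mB; rewrite -[X in measurable X]setTI; exact: mX. Qed.

Lemma integral_prod_independent : mutually_independent P X ->
  (\int[P]_t (\prod_i g i (X i t))%:E = (\prod_i m i)%:E)%E.
Proof.
move=> indep.
(* the functions [g i] replace indicators one coordinate at a time *)
suff H (s : seq I) (B : I -> set R) : (forall i, measurable (B i)) ->
    (\int[P]_t (\prod_i F s B i (X i t))%:E = (\prod_i M s B i)%:E)%E.
  have := H (enum I) (fun=> setT) (fun=> measurableT).
  have -> : (fun t => (\prod_i F (enum I) (fun=> setT) i (X i t))%:E) =
      (fun t => (\prod_i g i (X i t))%:E).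
    by apply/funext => t; congr EFin; apply: eq_bigr => i _; rewrite /F mem_enum.
  by move=> ->; congr EFin; apply: eq_bigr => i _; rewrite /M mem_enum.
elim: s B => [|j s IH] B mB.
  rewrite /M /= -indep//.
  have mcap : measurable (\bigcap_(i in [set: I]) (X i @^-1` B i)).
    by apply: fin_bigcap_measurable => // i _; exact: mpre.
  rewrite fineK ?fin_num_measure//.
  transitivity
    (\int[P]_t (\1_(\bigcap_(i in [set: I]) (X i @^-1` B i)) t)%:E)%E; last first.
    by rewrite integral_indic// setIT.
  apply: eq_integral => t _; congr EFin.
  rewrite indicE; have [tB|tB] := boolP (t \in _).
    rewrite big1// => i _; rewrite /F/= indicE mem_set//.
    by move/set_mem: tB; apply.
  have /existsNP[i /not_implyP[_ nB]] :
      ~ forall i, [set: I] i -> (X i @^-1` B i) t.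
    by move=> h; move/negP: tB; apply; exact/mem_set.
  by rewrite mulr0n; apply/eqP/prodf_eq0; exists i => //; rewrite /F/= indicE memNset// eqxx.
(* A repeated index changes nothing. *)
have [js|js] := boolP (j \in s).
  have E i : (i \in j :: s) = (i \in s).
    by rewrite inE; case: eqP => // ->; rewrite js.
  rewrite /F /M; under eq_integral do under eq_bigr do rewrite E.
  under [in RHS]eq_bigr do rewrite E.
  exact: IH.
(* The factors other than [j] become the weight of [integral_transfer], with constant [c]. *)
pose Hj t := \prod_(i | i != j) F s B i (X i t).
pose c := \prod_(i | i != j) M s B i.
have E i : i != j -> (i \in j :: s) = (i \in s) by rewrite inE => /negbTE ->.
transitivity (\int[P]_t (Hj t * g j (X j t))%:E)%E.
  apply: eq_integral => t _; congr EFin; rewrite (bigD1 j)//= mulrC.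
  rewrite {2}/F mem_head; congr (_ * _).
  by apply: eq_bigr => i ij; rewrite /F E.
rewrite (bigD1 j)//= {1}/M mem_head mulrC.
under eq_bigr do rewrite /M E//.
rewrite -/c EFinM -gm.
apply: integral_transfer => //.
- rewrite /Hj; under eq_fun do rewrite big_mkcond.
  apply: measurable_prod => i _; case: (i != j) => //.
  by apply: measurableT_comp => //; exact: mF.
- by move=> t; rewrite /Hj prodr_ge0.
move=> B' mB'.
(* As [j] is not in [s], its hybrid factor is still an indicator. Putting [B'] in place of [B j]
   turns the hypothesis on indicators into the induction hypothesis. *)
pose B'' i := if i == j then B' else B i.
have mB'' i : measurable (B'' i) by rewrite /B''; case: ifP.
have FB i : F s B'' i = if i == j then \1_B' else F s B i.
  by rewrite /F /B''; case: eqP => // ->; rewrite (negbTE js).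
have MB i : M s B'' i = if i == j then fine (P (X j @^-1` B')) else M s B i.
  by rewrite /M /B''; case: eqP => // ->; rewrite (negbTE js).
have Mj : \prod_i M s B'' i = c * fine (P (X j @^-1` B')).
  rewrite (bigD1 j)//= mulrC MB eqxx; congr (_ * _).
  by apply: eq_bigr => i ij; rewrite MB (negbTE ij).
transitivity (\int[P]_t (\prod_i F s B'' i (X i t))%:E)%E.
  apply: eq_integral => t _; congr EFin; rewrite [RHS](bigD1 j)//= [RHS]mulrC FB eqxx.
  by congr (_ * _); apply: eq_bigr => i ij; rewrite FB (negbTE ij).
by rewrite IH// Mj EFinM fineK// fin_num_measure//; exact: mpre.
Qed.

End independence.

(** * Gaussian and Bernoulli moment generating functions *)

Lemma integral_expR_normal_pdf (R : realType) (b s : R) : s != 0 ->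
  (\int[lebesgue_measure]_x (normal_pdf 0 s x * expR (b * x))%:E =
   (expR (b ^+ 2 * s ^+ 2 / 2))%:E)%E.
Proof.
move=> s0.
(* Completing the square: the exponential tilt by [b] moves the mean from 0 to [b * s ^+ 2], at the
   cost of the stated factor. *)
transitivity (\int[lebesgue_measure]_x
    ((expR (b ^+ 2 * s ^+ 2 / 2))%:E * (normal_pdf (b * s ^+ 2) s x)%:E))%E.
  apply: eq_integral => x _; rewrite -EFinM; congr EFin.
  rewrite !normal_pdfE//= -[LHS]mulrA [RHS]mulrCA; congr (_ * _).
  rewrite /normal_fun -!expRD; congr expR; field.
  by [].
rewrite ge0_integralZl_EFin//.
- by rewrite integral_normal_pdf mule1.
- by move=> x _; rewrite lee_fin normal_pdf_ge0.
- by apply/measurable_EFinP; exact: measurable_normal_pdf.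
Qed.

Section mgf.
Context d (T : measurableType d) (R : realType) (P : probability T R).

Lemma mgf_normal (X : T -> R) (b s : R) : s != 0 -> measurable_fun setT X ->
  (forall B, measurable B -> P (X @^-1` B) = normal_prob 0 s B) ->
  (\int[P]_t (expR (b * X t))%:E = (expR (b ^+ 2 * s ^+ 2 / 2))%:E)%E.
Proof.
move=> s0 mX PX; rewrite -integral_expR_normal_pdf//.
(* The weight is the normal density on the line, so the indicator hypothesis is the law of [X]. *)
rewrite (@integral_transfer _ _ _ _ _ _ _ lebesgue_measure P id X _ 1 _ _ _ _ _
  (fun x => expR (b * x))) ?mul1e//.
- exact: measurable_normal_pdf.
- by move=> t; exact: normal_pdf_ge0.
- move=> B mB; rewrite mul1e; transitivity (normal_prob 0 s B); last exact/esym/PX.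
  rewrite /normal_prob [RHS]integral_mkcond.
  by apply: eq_integral => x _ /=; rewrite restrict_EFin/= patch_indic.
- by apply: measurableT_comp => //; exact: measurable_funM.
Qed.

Lemma mgf_bernoulli (X : T -> R) (a p : R) : measurable_fun setT X ->
  (forall t, X t = 0 \/ X t = 1) -> P [set t | X t = 1] = p%:E ->
  (\int[P]_t (expR (a * X t))%:E = (1 + p * (expR a - 1))%:E)%E.
Proof.
move=> mX X01 Xp.
have mA : measurable [set t | X t = 1].
  by rewrite -[X in measurable X]setTI; exact: (mX measurableT [set 1]).
transitivity (\int[P]_t ((expR a)%:E * (\1_[set t | X t = 1] t)%:E +
    (\1_(~` [set t | X t = 1]) t)%:E))%E.
  apply: eq_integral => t _; rewrite -EFinM -EFinD; congr EFin.
  rewrite !indicE in_setC.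
  have [Xt|Xt] := X01 t.
    have X1 : ~ [set t | X t = 1] t.
      by rewrite /= Xt => /esym/eqP; rewrite oner_eq0.
    by rewrite memNset//= Xt !mulr0 expR0 add0r.
  rewrite mem_set//= Xt !mulr1 addr0//.
have m1 : measurable_fun setT (fun t => (\1_[set t | X t = 1] t)%:E : \bar R).
  by apply/measurable_EFinP.
have m2 : measurable_fun setT (fun t => (\1_(~` [set t | X t = 1]) t)%:E : \bar R).
  by apply/measurable_EFinP; apply: measurable_indic; exact: measurableC.
rewrite ge0_integralD//=; last by apply: measurable_funeM.
rewrite ge0_integralZl_EFin//= ?expR_ge0//.
rewrite !integral_indic//; last exact: measurableC.
rewrite !setIT.
have PC : P (~` [set t | X t = 1]) = (1 - p)%:E.
  by rewrite probability_setC// Xp -EFinB.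
transitivity ((expR a)%:E * p%:E + (1 - p)%:E)%E.
  by congr (_ * _ + _)%E; [exact: Xp|exact: PC].
by rewrite -EFinM -EFinD; congr EFin; ring.
Qed.

End mgf.

(** * Elementary exponential inequalities *)

Section real_bounds.
Variable R : realType.

(** Invert [1 - a <= expR (- a)]. There is no lower bound on [a], so both signs of the exponent are
    covered. *)
Lemma expR_upper2 (a : R) : a <= 1 / 2 -> expR a <= 1 + a + 2 * a ^+ 2.
Proof.
move=> a2.
have a1 : 0 < 1 - a by lra.
have h : (expR a)^-1 >= 1 - a by rewrite -expRN; exact: expR_ge1Dx.
have : expR a <= (1 - a)^-1.
  by rewrite -[leLHS]invrK lef_pV2 ?posrE ?invr_gt0 ?expR_gt0.
move/le_trans; apply; rewrite -[leLHS]mul1r ler_pdivrMr//.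
have a20 : 0 <= a ^+ 2 * (1 - 2 * a) by rewrite mulr_ge0 ?sqr_ge0//; lra.
rewrite -subr_ge0.
by have -> : (1 + a + 2 * a ^+ 2) * (1 - a) - 1 = a ^+ 2 * (1 - 2 * a) by ring.
Qed.

(** With [a = u / (p n)], the first-order term [n p a = u] cancels the prefactor, and only
    [2 n p a^2] remains. *)
Lemma bernoulli_mgf_le (n : nat) (p u : R) : 0 < p <= 1 -> (0 < n)%N ->
  u / (p * n%:R) <= 1 / 2 ->
  expR (- u) * (1 + p * (expR (u / (p * n%:R)) - 1)) ^+ n <=
  expR (2 * u ^+ 2 / (p * n%:R)).
Proof.
move=> /andP[p0 p1] n0; set a := u / _ => a2.
have n0' : 0 < n%:R :> R by rewrite ltr0n.
have base0 : 0 <= 1 + p * (expR a - 1).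
  have : 0 <= p * expR a by rewrite mulr_ge0 ?expR_ge0// ltW.
  lra.
have H : (1 + p * (expR a - 1)) ^+ n <= expR (n%:R * (p * (a + 2 * a ^+ 2))).
  rewrite expRM_natl lerXn2r ?nnegrE ?expR_ge0//.
  apply: (le_trans _ (expR_ge1Dx _)).
  rewrite lerD2l ler_wpM2l ?(ltW p0)//.
  by have := expR_upper2 a a2; lra.
apply: (le_trans (ler_wpM2l (expR_ge0 _) H)).
rewrite -expRD ler_expR le_eqVlt; apply/orP; left; apply/eqP.
rewrite /a; field.
by rewrite !gt_eqF.
Qed.

(** Each of the [k] factors [4 y] is at most [r * expR (4 y / r - 1)], which gives both [r ^+ k] and
    the decay in [k]. The factors [1 + y] are absorbed using [y <= y / r]. *)
Lemma power_mul_le_expR (k : nat) (r y : R) : 0 < r -> r < 1 -> 0 <= y ->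
  y * (4 * y * (1 + y)) ^+ k <=
  r ^+ k / 4 * expR (- k.+1%:R) * expR (4 * k.*2.+1%:R / r * y).
Proof.
move=> r0 r1 y0.
have rn0 : r != 0 by rewrite gt_eqF.
have hy : 4 * y <= r * expR (4 * y / r - 1).
  have := expR_ge1Dx (4 * y / r - 1).
  rewrite addrC subrK => /(ler_wpM2l (ltW r0)).
  by rewrite mulrC divfK.
have hy1 : 1 + y <= expR y := expR_ge1Dx y.
have h1 : (4 * y * (1 + y)) ^+ k <=
    r ^+ k * expR (k%:R * (4 * y / r - 1 + y)).
  rewrite expRM_natl -exprMn lerXn2r ?nnegrE ?mulr_ge0
    ?expR_ge0 ?addr_ge0 ?(ltW r0)//.
  by rewrite expRD mulrA ler_pM ?mulr_ge0 ?addr_ge0.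
(* The unpaired factor [y] gives up its power of [r]; the target exponent after squaring is [2k]. *)
have h2 : y <= 1 / 4 * expR (4 * y / r - 1).
  have : r * expR (4 * y / r - 1) <= expR (4 * y / r - 1).
    by rewrite ler_piMl ?expR_ge0// ltW.
  lra.
apply: (le_trans (ler_pM _ _ h2 h1)) => //.
  by rewrite exprn_ge0// mulr_ge0 ?addr_ge0 ?mulr_ge0.
have E u w : 1 / 4 * expR u * (r ^+ k * expR w) = r ^+ k / 4 * expR (u + w).
  by rewrite expRD; ring.
rewrite E -[leRHS]mulrA -expRD.
rewrite ler_wpM2l ?divr_ge0 ?exprn_ge0 ?(ltW r0)//.
rewrite ler_expR -subr_ge0.
have yr : y <= y / r by rewrite ler_pdivlMr// ler_piMr// ltW.
have k0 : 0 <= k%:R :> R by [].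
have -> : k.*2.+1%:R = 2 * k%:R + 1 :> R by rewrite -addn1 natrD -muln2 natrM mulrC.
have -> : k.+1%:R = k%:R + 1 :> R by rewrite -addn1 natrD.
have -> : - (k%:R + 1) + 4 * (2 * k%:R + 1) / r * y -
  (4 * y / r - 1 + k%:R * (4 * y / r - 1 + y)) =
  k%:R * (4 * (y / r) - y) by field.
by rewrite mulr_ge0//; lra.
Qed.

End real_bounds.

(** * Moment generating function of the first-row error *)

Lemma prod_first_row (R : comPzSemiRingType) (n : nat) (hn : (0 < n)%N) (F : 'I_n -> R) :
  \prod_(p : upper_index n)
    (if (sval p).1 == Ordinal hn then F (sval p).2 else 1) = \prod_j F j.
Proof.
(* The whole first row lies on or above the diagonal, so [h] embeds it among the independent
   entries. *)
pose h (j : 'I_n) : upper_index n := exist _ (Ordinal hn, j) (leq0n j).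
rewrite -big_mkcond (reindex_onto h (fun p => (sval p).2))/=.
  by apply: eq_bigl => j; rewrite !eqxx.
move=> [[i j] ij] /= /eqP hi; apply: val_inj => /=.
by rewrite -hi.
Qed.

Section first_row.
Context d (T : measurableType d) (R : realType) (P : probability T R).
Variables (n : nat) (hn : (0 < n)%N) (rho : R).
Variables (v : 'I_n -> T -> R) (W : 'I_n -> 'I_n -> T -> R).
Hypothesis mv : forall i, measurable_fun setT (v i).
Hypothesis mW : forall i j, measurable_fun setT (W i j).
Hypothesis v01 : forall i t, v i t = 0 \/ v i t = 1.
Hypothesis Pv : forall i, P [set t | v i t = 1] = rho%:E.
Hypothesis PW : forall (i j : 'I_n), (i < j)%N ->
  forall B : set R, measurable B -> P (W i j @^-1` B) = normal_prob 0 1 B.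
Hypothesis PWd : forall (i : 'I_n) (B : set R), measurable B ->
  P (W i i @^-1` B) = normal_prob 0 (Num.sqrt 2) B.
Hypothesis indep : mutually_independent P
  (fun a : 'I_n + upper_index n =>
     match a with inl i => v i | inr p => W (sval p).1 (sval p).2 end).

Let i1 := Ordinal hn.

(** The diagonal entry has variance 2, hence the second [b ^+ 2 / 2]. *)
Lemma mgf_first_row_noise (j : 'I_n) (b : R) :
  (\int[P]_t (expR (b * W i1 j t))%:E =
   (expR (b ^+ 2 / 2 + if j == i1 then b ^+ 2 / 2 else 0))%:E)%E.
Proof.
case: eqP => [->|/eqP ji].
  rewrite (@mgf_normal _ _ _ _ _ _ (Num.sqrt 2))//; last exact: PWd.
  by rewrite sqr_sqrtr//; congr (expR _)%:E; field.
rewrite (@mgf_normal _ _ _ _ _ _ 1) ?oner_eq0//; last first.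
  apply: PW => /=; rewrite lt0n; apply: contra ji => /eqP j0.
  by apply/eqP/val_inj.
by rewrite expr1n mulr1 addr0.
Qed.

(** Independence is applied to the full family, with the constant 1 on entries outside the first
    row. The diagonal entry counts twice, which gives [n.+1]. *)
Lemma mgf_first_row (a b : R) :
  (\int[P]_t (expR (a * (\sum_i v i t) + b * \sum_j W i1 j t))%:E =
   ((1 + rho * (expR a - 1)) ^+ n * expR (b ^+ 2 * n.+1%:R / 2))%:E)%E.
Proof.
pose g (s : 'I_n + upper_index n) (x : R) : R := match s with
  | inl _ => expR (a * x)
  | inr p => if (sval p).1 == i1 then expR (b * x) else 1 end.
pose m (s : 'I_n + upper_index n) : R := match s with
  | inl _ => 1 + rho * (expR a - 1)
  | inr p => if (sval p).1 == i1 then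
      expR (b ^+ 2 / 2 + if (sval p).2 == i1 then b ^+ 2 / 2 else 0) else 1 end.
have Mm : \prod_s m s =
    (1 + rho * (expR a - 1)) ^+ n * expR (b ^+ 2 * n.+1%:R / 2).
  rewrite big_sumType/= prodr_const card_ord; congr (_ * _).
  rewrite (prod_first_row _ _ hn (fun j =>
    expR (b ^+ 2 / 2 + if j == i1 then b ^+ 2 / 2 else 0))).
  rewrite -expR_sum big_split/= sumr_const card_ord -big_mkcond big_pred1_eq.
  by congr expR; rewrite -addn1 natrD -mulr_natr; ring.
have E t : \prod_i g i (match i with inl i => v i | inr p => W (sval p).1 (sval p).2 end t) =
    expR (a * (\sum_i v i t) + b * \sum_j W i1 j t).
  rewrite big_sumType/= expRD !mulr_sumr !expR_sum; congr (_ * _).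
  rewrite -(prod_first_row _ _ hn); apply: eq_bigr => p _.
  by case: eqP => // <-.
under eq_integral do rewrite -E.
rewrite -Mm; apply: (@integral_prod_independent _ T R P _
  (fun i => match i with inl i => v i | inr p => W (sval p).1 (sval p).2 end) g m) => //.
- by case.
- case=> [i|p]; rewrite /g /=.
    by apply: measurableT_comp => //; exact: measurable_funM.
  case: ((sval p).1 == i1) => //; apply: measurableT_comp => //; exact: measurable_funM.
- by case=> [i|p] x; rewrite /g /=; [|case: ifP => // _]; exact: expR_ge0.
- case=> [i|[[i j] ij]]; rewrite /g /m /=; first exact: mgf_bernoulli.
  case: eqP => [->|_]; first exact: mgf_first_row_noise.
  by rewrite integral_cst// mul1e; exact: probability_setT.
Qed.

(* On [v i1 t = 0] the Bernoulli part of the error vanishes, so the exponential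
   is bounded by the sum of its values for [v i1 t = 0] and [v i1 t = 1]; this
   avoids conditioning on [v i1]. *)
Lemma mgf_error_le (lambda u : R) : 0 < lambda -> 0 < rho <= 1 ->
  u / (rho * n%:R) <= 1 / 2 ->
  (\int[P]_t (expR (u * (v i1 t * ((\sum_i v i t) / (rho * n%:R) - 1) +
     (\sum_j W i1 j t) / (lambda * rho * n%:R))))%:E <=
  (expR ((u / (lambda * rho * n%:R)) ^+ 2 * n.+1%:R / 2) *
     (1 + expR (2 * u ^+ 2 / (rho * n%:R))))%:E)%E.
Proof.
move=> l0 p01 hu; set b := u / (lambda * rho * n%:R).
set a := u / (rho * n%:R).
have mS : measurable_fun setT (fun t => \sum_i v i t).
  by apply: measurable_sum => i.
have mN : measurable_fun setT (fun t => \sum_j W i1 j t).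
  by apply: measurable_sum => j.
have mE x y : measurable_fun setT
    (fun t => (expR (x * (\sum_i v i t) + y * \sum_j W i1 j t))%:E : \bar R).
  apply/measurable_EFinP; apply: measurableT_comp => //.
  by apply: measurable_funD; apply: measurable_funM.
(* The coefficient 0 puts the case [v i1 t = 0] in the shape of [mgf_first_row], where its Bernoulli
   factor is 1. *)
apply: (@le_trans _ _ (\int[P]_t ((expR (0 * (\sum_i v i t) + b * \sum_j W i1 j t))%:E +
    (expR (- u))%:E * (expR (a * (\sum_i v i t) + b * \sum_j W i1 j t))%:E))%E).
  apply: ge0_le_integral => //.
  - apply/measurable_EFinP; apply: measurableT_comp => //.
    apply: measurable_funM => //; apply: measurable_funD.
      apply: measurable_funM => //; apply: measurable_funB => //.
      by apply: measurable_funM.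
    by apply: measurable_funM.
  - by apply: emeasurable_funD => //; apply: measurable_funeM.
  move=> t _; rewrite -EFinM -EFinD lee_fin -expRD.
  have [->|->] := v01 i1 t.
    have -> : u * (0 * ((\sum_i v i t) / (rho * n%:R) - 1) +
        (\sum_j W i1 j t) / (lambda * rho * n%:R)) =
      0 * (\sum_i v i t) + b * \sum_j W i1 j t by rewrite /b; ring.
    by rewrite lerDl expR_ge0.
  have -> : u * (1 * ((\sum_i v i t) / (rho * n%:R) - 1) +
        (\sum_j W i1 j t) / (lambda * rho * n%:R)) =
      - u + (a * (\sum_i v i t) + b * \sum_j W i1 j t) by rewrite /a /b; ring.
  by rewrite lerDr expR_ge0.
rewrite ge0_integralD//=; last by apply: measurable_funeM.
rewrite ge0_integralZl_EFin ?expR_ge0//.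
rewrite !mgf_first_row -EFinM -EFinD lee_fin expR0 subrr mulr0 addr0 expr1n mul1r.
have := bernoulli_mgf_le _ n rho u p01 hn hu; rewrite -/a.
move/(ler_wpM2l (expR_ge0 (b ^+ 2 * n.+1%:R / 2))) => le.
rewrite [leRHS]mulrDr mulr1 lerD2l; apply: le_trans le.
by rewrite [leLHS]mulrA [leLHS]mulrC.
Qed.

End first_row.

(** * Numerical constants and the pointwise bound on the squared error *)

Lemma ln_ge1 (R : realType) (x : R) : 4 <= x -> 1 <= ln x.
Proof.
move=> x4; rewrite -[leLHS](expRK 1) ler_ln ?posrE ?expR_gt0//; last by lra.
apply: le_trans x4.
(* The quadratic bound at 1/2 gives [expR (1 / 2) <= 2], hence [expR 1 <= 4]. *)
have -> : expR 1 = expR (1 / 2) ^+ 2 :> R.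
  by rewrite -expRM_natl; congr expR; lra.
have h := @expR_upper2 R (1 / 2) (lexx _).
have : expR (1 / 2) <= 2 :> R by lra.
rewrite -(@ler_pXn2r _ 2) ?nnegrE ?expR_ge0// => /le_trans; apply.
by lra.
Qed.

(* With [u = 8 D / r], the Gaussian exponent is at most [64 D^2 / (1152 D)] and
   the Bernoulli one at most [128 D^2 / (648 D)]. *)
Lemma error_constant_le (R : realType) (k : nat) (b g : R) :
  b <= k.*2.+1%:R / 18 -> g <= k.*2.+1%:R / 5 ->
  (1 / 4 * expR (- k.+1%:R)) ^+ 2 * (2 * (expR b * (1 + expR g))) <= 1.
Proof.
move=> hb hg.
have dk : k.*2.+1%:R = 2 * k%:R + 1 :> R.
  by rewrite -addn1 natrD -muln2 natrM mulrC.
have k0 : 0 <= k%:R :> R by [].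
have h1 : expR g <= expR (k.*2.+1%:R / 5) by rewrite ler_expR.
have h2 : 1 <= expR (k.*2.+1%:R / 5 : R).
  by rewrite -[leLHS]expR0 ler_expR divr_ge0.
have h3 : expR b * (1 + expR g) <=
    2 * expR (k.*2.+1%:R / 18 + k.*2.+1%:R / 5).
  rewrite expRD mulrCA ler_pM ?expR_ge0 ?addr_ge0 ?expR_ge0 ?ler_expR//; lra.
(* The constants are [1/16 * 2 * 2 = 1/4]; the remaining exponent is at most
   [-2(k+1) + (2k+1)(1/18 + 1/5)], which is negative. *)
apply: (@le_trans _ _ (1 / 4 *
    (expR (- k.+1%:R) ^+ 2 * expR (k.*2.+1%:R / 18 + k.*2.+1%:R / 5)))).
  have e0 : 0 <= expR (- k.+1%:R : R) ^+ 2 by rewrite exprn_ge0 ?expR_ge0.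
  have := ler_wpM2l e0 h3; lra.
rewrite -expRM_natl -expRD.
have : expR (2%:R * - k.+1%:R + (k.*2.+1%:R / 18 + k.*2.+1%:R / 5)) <= 1 :> R.
  by rewrite expR_le1 dk -[k.+1]addn1 natrD; lra.
lra.
Qed.

(** Squaring doubles the exponent [4 D / r], and the exponential of [|e|] is at most the sum of
    those of both signs, which have computable means. *)
Lemma tau_sqr_error_le (R : realType) (k : nat) (r x e : R) :
  0 < r -> r < 1 -> x = 0 \/ x = 1 ->
  (tau k (x + e) - x) ^+ 2 <=
  (k.*2.+1%:R * r ^+ k) ^+ 2 * (1 / 4 * expR (- k.+1%:R)) ^+ 2 *
  (expR (8 * k.*2.+1%:R / r * e) + expR (- (8 * k.*2.+1%:R / r) * e)).
Proof.
move=> r0 r1 x01.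
have h1 := tau_dist_le _ k x e x01.
have h2 := power_mul_le_expR _ k r `|e| r0 r1 (normr_ge0 e).
have h3 : `|tau k (x + e) - x| <= k.*2.+1%:R * (r ^+ k / 4 *
    expR (- k.+1%:R) * expR (4 * k.*2.+1%:R / r * `|e|)).
  by apply: (le_trans h1); rewrite -mulrA ler_wpM2l.
rewrite -[leLHS]real_normK ?num_real//.
have h4 : `|tau k (x + e) - x| ^+ 2 <= (k.*2.+1%:R * (r ^+ k / 4 *
    expR (- k.+1%:R) * expR (4 * k.*2.+1%:R / r * `|e|))) ^+ 2.
  rewrite lerXn2r ?nnegrE// mulr_ge0// !mulr_ge0 ?expR_ge0 ?exprn_ge0 ?(ltW r0)//.
apply: (le_trans h4).
have E : expR (4 * k.*2.+1%:R / r * `|e|) ^+ 2 = expR (8 * k.*2.+1%:R / r * `|e|).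
  by rewrite -expRM_natl; congr expR; ring.
rewrite !exprMn E.
have h5 : expR (8 * k.*2.+1%:R / r * `|e|) <=
    expR (8 * k.*2.+1%:R / r * e) + expR (- (8 * k.*2.+1%:R / r) * e).
  case: (ger0P e) => _; first by rewrite lerDl expR_ge0.
  by rewrite mulrN -mulNr lerDr expR_ge0.
have c0 : 0 <= k.*2.+1%:R ^+ 2 * (r ^+ k) ^+ 2 * (4^-1 ^+ 2 * expR (- k.+1%:R) ^+ 2).
  by rewrite -!exprMn sqr_ge0.
have := ler_wpM2l c0 h5; lra.
Qed.

(** * Assembling the mean squared error bound *)

Theorem mainTheorem12 (R : realType) (d : measure_display) (T : measurableType d)
  (P : probability T R) (n : nat) (hn : (0 < n)%N) (lambda rho r : R) (k : nat)
  (v : 'I_n -> T -> R) (W : 'I_n -> 'I_n -> T -> R) :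
  0 < lambda -> 0 < rho -> rho < 1 -> rho <= 1 / 2 ->
  (forall i, measurable_fun setT (v i)) ->
  (forall i j, measurable_fun setT (W i j)) ->
  (forall i t, v i t = 0 \/ v i t = 1) ->
  (forall i, P [set t | v i t = 1] = rho%:E) ->
  (forall i j t, W i j t = W j i t) ->
  (forall (i j : 'I_n), (i < j)%N -> forall B : set R, measurable B ->
     P (W i j @^-1` B) = normal_prob 0 1 B) ->
  (forall (i : 'I_n) (B : set R), measurable B -> P (W i i @^-1` B) = normal_prob 0 (Num.sqrt 2) B) ->
  mutually_independent P
    (fun a : 'I_n + upper_index n =>
       match a with inl i => v i | inr p => W (sval p).1 (sval p).2 end) ->
  0 < r -> r < 1 ->
  let D := k.*2.+1 in
  let L := ln 8 + 2 * D%:R * ln (9 / rho) in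
  lambda >= 24 / (r * rho * Num.sqrt n%:R) * Num.sqrt L ->
  rho >= 324 / (r ^+ 2 * n%:R) * L ->
  let Y i j t := lambda * v i t * v j t + W i j t in
  let i1 := Ordinal hn in
  let f t := tau k ((lambda * rho * n%:R)^-1 * \sum_(i < n) Y i1 i t) in
  (\int[P]_t ((f t - v i1 t) ^+ 2)%:E <= (D%:R ^+ 2 * r ^+ (D.-1))%:E)%E.
Proof.
move=> l0 p0 p1 p2 mv mW v01 Pv _ PW PWd indep r0 r1 D L hl hr.
pose i1 := Ordinal hn.
pose f t := tau k ((lambda * rho * n%:R)^-1 *
  \sum_(i < n) (lambda * v i1 t * v i t + W i1 i t)).
change (\int[P]_t ((f t - v i1 t) ^+ 2)%:E <=
  (D%:R ^+ 2 * r ^+ (D.-1))%:E)%E.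
have D1 : 1 <= D%:R :> R by rewrite ler1n.
have n0 : 0 < n%:R :> R by rewrite ltr0n.
have n1 : 1 <= n%:R :> R by rewrite ler1n.
have LD : 2 * D%:R <= L.
  have ln8 : 1 <= ln 8 :> R by apply: ln_ge1; lra.
  have ln9 : 1 <= ln (9 / rho) by apply: ln_ge1; rewrite ler_pdivlMr//; lra.
  have : 2 * D%:R * 1 <= 2 * D%:R * ln (9 / rho) by rewrite ler_wpM2l// mulr_ge0.
  rewrite /L; lra.
have L0 : 0 <= L by lra.
(* [A] controls the Bernoulli exponent; the condition on [rho] reads [324 L <= A], and
   [648 = 2 * 324]. *)
pose A := r ^+ 2 * (rho * n%:R).
have A0 : 0 < A by rewrite !mulr_gt0// exprn_gt0.
have hA : 648 * D%:R <= A.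
  have : 324 * L <= A.
    move: hr; rewrite mulrAC ler_pdivrMr ?mulr_gt0 ?exprn_gt0// /A; lra.
  lra.
(* [B] controls the Gaussian exponent; squaring the condition on [lambda] gives [576 L <= B], and
   [1152 = 2 * 576]. *)
pose B := r ^+ 2 * (lambda ^+ 2 * rho ^+ 2 * n%:R).
have B0 : 0 < B by rewrite !mulr_gt0// exprn_gt0.
have hB : 1152 * D%:R <= B.
  have : 576 * L <= B.
    have q0 : 0 < r * rho * Num.sqrt n%:R by rewrite !mulr_gt0// sqrtr_gt0.
    move: hl; rewrite mulrAC ler_pdivrMr// => hl.
    have h24 : 0 <= 24 * Num.sqrt L by rewrite mulr_ge0// sqrtr_ge0.
    have : (24 * Num.sqrt L) ^+ 2 <= (lambda * (r * rho * Num.sqrt n%:R)) ^+ 2.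
      by rewrite lerXn2r ?nnegrE// (le_trans h24).
    rewrite !exprMn !sqr_sqrtr// ?(ltW n0)// /B; lra.
  lra.
pose s := 8 * D%:R / r.
have s2 : s ^+ 2 = 64 * D%:R ^+ 2 / r ^+ 2 by rewrite /s; field; rewrite gt_eqF.
pose e t := v i1 t * ((\sum_i v i t) / (rho * n%:R) - 1) +
     (\sum_j W i1 j t) / (lambda * rho * n%:R).
have fE t : f t = tau k (v i1 t + e t).
  rewrite /f /e big_split/= -mulr_sumr; congr tau.
  by field; rewrite !gt_eqF.
(* Stated so as to cover both [u = s] and [u = - s]. *)
have mgf u : u ^+ 2 = s ^+ 2 -> u <= s ->
    (\int[P]_t (expR (u * e t))%:E <=
     (expR (D%:R / 18) * (1 + expR (D%:R / 5)))%:E)%E.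
  move=> us ule.
  (* Since [r < 1], [A <= r * (rho * n)], so [648 D <= A] leaves ample room for the needed
     [16 D]. *)
  have hu : u / (rho * n%:R) <= 1 / 2.
    rewrite ler_pdivrMr ?mulr_gt0//; apply: (le_trans ule).
    rewrite /s ler_pdivrMr//.
    have := ler_wpM2r (mulr_ge0 (ltW r0) (mulr_ge0 (ltW p0) (ltW n0))) (ltW r1).
    move: hA; rewrite /A; lra.
  have p01 : 0 < rho <= 1 by rewrite p0 ltW.
  have M := mgf_error_le _ _ _ _ _ hn rho v W mv mW v01 Pv PW PWd indep lambda u l0 p01 hu.
  apply: (le_trans M).
  rewrite lee_fin ler_pM ?expR_ge0 ?addr_ge0 ?expR_ge0//.
    rewrite ler_expR exprMn us s2.
    (* Here [n + 1 <= 2 n] absorbs the extra diagonal variance. *)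
    apply: (@le_trans _ _ (64 * D%:R ^+ 2 / B)).
      have -> : 64 * D%:R ^+ 2 / B = 64 * D%:R ^+ 2 / r ^+ 2 *
          (lambda * rho * n%:R)^-1 ^+ 2 * (2 * n%:R) / 2.
        by rewrite /B; field; rewrite !gt_eqF.
      rewrite ler_wpM2r// ler_wpM2l//; last by rewrite -addn1 natrD; lra.
      by rewrite -s2 mulr_ge0 ?sqr_ge0.
    rewrite ler_pdivrMr//.
    have := ler_wpM2l (ler0n R D) hB; lra.
  rewrite lerD2l ler_expR us s2.
  have -> : 2 * (64 * D%:R ^+ 2 / r ^+ 2) / (rho * n%:R) = 128 * D%:R ^+ 2 / A.
    by rewrite /A; field; rewrite !gt_eqF.
  rewrite ler_pdivrMr//.
  have := ler_wpM2l (ler0n R D) hA; have := sqr_ge0 (D%:R : R); lra.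
pose K := (D%:R * r ^+ k) ^+ 2 * (1 / 4 * expR (- k.+1%:R)) ^+ 2.
have K0 : 0 <= K by rewrite mulr_ge0 ?sqr_ge0.
have me : measurable_fun setT e.
  apply: measurable_funD; apply: measurable_funM => //.
    apply: measurable_funB => //; apply: measurable_funM => //.
    by apply: measurable_sum => i.
  by apply: measurable_sum => i.
have mexp u : measurable_fun setT (fun t => (expR (u * e t))%:E : \bar R).
  by apply/measurable_EFinP; apply: measurableT_comp => //; apply: measurable_funM.
apply: (@le_trans _ _ (\int[P]_t (K%:E * ((expR (s * e t))%:E + (expR (- s * e t))%:E)))%E).
  apply: ge0_le_integral => //.
  - by move=> t _; rewrite lee_fin sqr_ge0.
  - apply/measurable_EFinP; apply: measurable_funX; apply: measurable_funB => //.
    rewrite (_ : f = fun t => tau k (v i1 t + e t)); last exact/funext.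
    by apply: measurableT_comp; [exact: measurable_tau|exact: measurable_funD].
  - by apply: measurable_funeM; apply: emeasurable_funD.
  - by move=> t _; rewrite -EFinD -EFinM lee_fin fE; exact: tau_sqr_error_le.
rewrite ge0_integralZl_EFin//; last 2 first.
- by move=> t _; rewrite -EFinD lee_fin addr_ge0 ?expR_ge0.
- exact: emeasurable_funD.
rewrite ge0_integralD//.
have ms : - s <= s by rewrite -subr_ge0 opprK addr_ge0// divr_ge0 ?mulr_ge0// ltW.
have := leeD (mgf s erefl (lexx s)) (mgf (- s) (sqrrN s) ms).
move/(lee_wpmul2l (x := K%:E)); rewrite lee_fin => /(_ K0) /le_trans; apply.
rewrite -EFinD -EFinM lee_fin -mulr2n -[_ *+ 2]mulr_natl /K -[leLHS]mulrA.
rewrite [leRHS](_ : _ = (D%:R * r ^+ k) ^+ 2 * 1); last first.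
  by rewrite mulr1 exprMn -(exprM r k 2) muln2.
rewrite ler_wpM2l ?sqr_ge0//.
exact: error_constant_le.
Qed.
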